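(* Let $M$ be a melon graph. Then $\mathcal{R}(M)=3$ if and only if $M$ contains an induced subgraph (isomorphic to a graph) from $\mathcal{M}_3\cup\mathcal{M}_4$.
   Context: All graphs are finite and simple. A melon graph $M=(E_1,\ldots,E_m)$ ($m\ge 1$) is the graph formed as the union of $m$ paths $E_1,\ldots,E_m$ (the constituent paths), all having the same two distinct endpoints $0$ and $0'$, and pairwise sharing no vertices other than $0$ and $0'$; since $M$ is simple, at most one constituent path has length one (length = number of edges). $\mathcal{M}_3$ is the family of melon graphs with exactly three constituent paths, each of length at least three. $\mathcal{M}_4$ is the family of melon graphs with exactly four constituent paths, of which one is of length one and the other three are of length at least three. Two letters $a\neq b$ alternate in a word $w$ if the subword of $w$ consisting of all occurrences of $a$ and $b$ is of the form $abab\cdots$ or $baba\cdots$ (of even or odd length). A word over $V$ is $k$-uniform if every letter of $V$ occurs in it exactly $k$ times. A word $w$ represents a graph $G=(V,E)$ if for all distinct $a,b\in V$: $\{a,b\}\in E$ if and only if $a$ and $b$ alternate in $w$. $G$ is $k$-word-representable if some $k$-uniform word over $V$ represents $G$; the representation number $\mathcal{R}(G)$ is the smallest such $k$. *)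

(* Defs.v *)
From mathcomp Require Import all_boot.

Set Implicit Arguments.
Unset Strict Implicit.
Unset Printing Implicit Defensive.

Record sgraph := SGraph {
  vertex :> finType;
  edge : rel vertex;
  edge_sym : symmetric edge;
  edge_irr : irreflexive edge }.

Arguments edge {s}.

Definition isomorphic (G H : sgraph) : Prop :=
  exists2 f : G -> H, bijective f & forall x y, edge (f x) (f y) = edge x y.

Section Induced.
Variables (G : sgraph) (A : {set G}).

Definition induced_edge : rel {x : G | x \in A} :=
  fun x y => edge (val x) (val y).

Lemma induced_sym : symmetric induced_edge.
Proof. by move=> x y; exact: edge_sym. Qed.

Lemma induced_irr : irreflexive induced_edge.
Proof. by move=> x; exact: edge_irr. Qed.

Definition induced : sgraph := SGraph induced_sym induced_irr.
End Induced.

Definition contains_induced (G H : sgraph) : Prop :=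
  exists A : {set G}, isomorphic (induced A) H.

(* Paths are given by their vertex sequences, endpoints included. *)
Definition path_length (T : eqType) (p : seq T) : nat := (size p).-1.

Definition is_path (T : eqType) (s t : T) (p : seq T) : Prop :=
  uniq p /\ exists q, p = s :: rcons q t.

Definition path_edge (T : eqType) (p : seq T) : rel T :=
  fun x y => infix [:: x; y] p || infix [:: y; x] p.

(* [s] and [t] play the roles of 0 and 0'.  Distinct indices must give distinct
   paths; by the disjointness condition this could only fail for two copies of
   the path consisting of the single edge [s t], hence [melon_simple]. *)
Record melon_paths (G : sgraph) (s t : G) (m : nat) (E : 'I_m -> seq G) : Prop
  := MelonPaths {
  melon_ends : s != t;
  melon_gt0 : 0 < m;
  melon_path : forall i, is_path s t (E i);
  melon_disjoint : forall i j x,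
    i != j -> x \in E i -> x \in E j -> x = s \/ x = t;
  melon_simple : forall i j,
    path_length (E i) = 1 -> path_length (E j) = 1 -> i = j;
  melon_vertex : forall x, exists i, x \in E i;
  melon_edge : forall x y, edge x y <-> exists i, path_edge (E i) x y }.

Definition melon (G : sgraph) : Prop :=
  exists (s t : G) (m : nat) (E : 'I_m -> seq G), melon_paths s t E.

Definition melon_M3 (G : sgraph) : Prop :=
  exists (s t : G) (E : 'I_3 -> seq G),
    melon_paths s t E /\ forall i, 3 <= path_length (E i).

Definition melon_M4 (G : sgraph) : Prop :=
  exists (s t : G) (E : 'I_4 -> seq G),
    melon_paths s t E /\
    exists2 i0, path_length (E i0) = 1 &
      forall i, i != i0 -> 3 <= path_length (E i).

Definition alternating_word (T : Type) (a b : T) (n : nat) : seq T :=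
  mkseq (fun i => if odd i then b else a) n.

Definition alternate (T : eqType) (a b : T) (w : seq T) : Prop :=
  exists n, [seq c <- w | (c == a) || (c == b)] = alternating_word a b n
         \/ [seq c <- w | (c == a) || (c == b)] = alternating_word b a n.

Definition uniform (T : eqType) (k : nat) (w : seq T) : Prop :=
  forall a, count_mem a w = k.

Definition represents (G : sgraph) (w : seq G) : Prop :=
  forall a b : G, a != b -> (edge a b <-> alternate a b w).

Definition k_word_representable (G : sgraph) (k : nat) : Prop :=
  exists2 w : seq G, uniform k w & represents w.

(* R(G) = k, with R(G) the least positive k; positivity discards the empty
   word, which is 0-uniform and represents every complete graph. *)
Definition representation_number (G : sgraph) (k : nat) : Prop :=
  [/\ 0 < k, k_word_representable G k
    & forall j, 0 < j -> k_word_representable G j -> k <= j].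

(* Main.v *)
Require Import Defs.
From mathcomp Require Import all_boot zify.

(** Call a constituent path of a melon graph long when its length is at least
    three. Any three long paths, together with the edge between the two ends if
    there is one, induce a graph of [melon_M3] or [melon_M4]
    ([long_contains]); so the theorem follows from three facts.

    - Every melon graph has a 3-uniform representing word
      ([melon_3_representable]).
    - A melon graph with at most two long paths has a 2-uniform representing
      word ([few_long_2_representable]).
    - A graph that contains a melon graph with three long paths as an induced
      subgraph has no 2-uniform representing word ([M3_M4_not_2]), hence no
      1-uniform one, as that could be doubled ([one_two_representable]).

    The words are grown one vertex at a time, starting from a short word on the
    two ends [s] and [t]. A new letter [v] is inserted in [k] places of a
    [k]-uniform word; it alternates exactly with the letters that occur once
    between any two consecutive copies of [v] ([insert_letter2],
    [insert_letter3]). Keeping the copies of [v] close together around one or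
    two letters thus gives [v] a prescribed neighbourhood of one or two
    vertices. A path is attached from one end to the other in this way: each
    vertex but the last is added as a leaf hanging from its predecessor, the
    last one is joined to its predecessor and to the far end. The last step
    needs the two letters it joins to be consecutive, and this is where the two
    uniformities differ. The 2-uniform words used here have two places where
    the letters [s] and [t] are consecutive; a long path uses up such a place,
    whereas a path of length two only wraps around it. In a 3-uniform word one
    copy of the first leaf can be put next to [t] while the other two surround
    a distant [s], so that long paths can be attached without limit
    ([insert_long3]).

    For the lower bound, a 2-uniform word is read as a chord diagram: the chord
    of a letter joins its two positions, and two letters alternate when their
    chords cross. The interiors of long paths are connected families of chords,
    and no chord of one crosses a chord of another, so two positions taken from
    one interior never separate two positions taken from another
    ([disjoint_chains]). If the chords of [s] and [t] are disjoint, the three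
    interiors run in parallel from one to the other; the middle one is enclosed
    by the outer two, yet its chord crossing that of [s] must leave the enclosed
    region ([middle_chain]). If the chords of [s] and [t] cross, each interior
    contains a chord around one of the two positions of [s], and two interiors
    that share such a position are incompatible ([pair_inner], [pair_outer]);
    among three interiors two must share one ([at_most_two_long]). *)

Set Implicit Arguments.
Unset Strict Implicit.
Unset Printing Implicit Defensive.

(** * Alternation in words *)

Section Alternation.
Variable T : eqType.
Implicit Types (a b v x y : T) (s w : seq T).

(** For two distinct letters, being of the form [abab...] means having no two
    equal neighbours; unlike the existential definition this can be computed. *)
Definition alt a b w : bool :=
  sorted (fun x y => x != y) [seq c <- w | (c == a) || (c == b)].

Lemma altC a b w : alt a b w = alt b a w.
Proof. by rewrite /alt; congr sorted; apply: eq_filter => c; rewrite orbC. Qed.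

Lemma alternating_wordS a b n :
  alternating_word a b n.+1 = a :: alternating_word b a n.
Proof.
rewrite /alternating_word /mkseq /= (iotaDl 1 0 n) -map_comp.
by congr cons; apply: eq_map => i /=; case: (odd i).
Qed.

Lemma alternating_word_path a b n :
  a != b -> path (fun x y => x != y) a (alternating_word b a n).
Proof.
elim: n a b => [|n IH] a b ab //.
by rewrite alternating_wordS /= ab IH // eq_sym.
Qed.

Lemma path_alternating_word a b s :
  all (fun c => (c == a) || (c == b)) s -> path (fun x y => x != y) a s ->
  s = alternating_word b a (size s).
Proof.
elim: s a b => [|c s IH] a b //= /andP[cab sab] /andP[ac cs].
move: cab; rewrite eq_sym (negPf ac) /= => /eqP cb; subst c.
rewrite alternating_wordS -IH //.
by apply: sub_all sab => c; rewrite orbC.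
Qed.

Lemma alternateE a b w : a != b -> alternate a b w <-> alt a b w.
Proof.
move=> ab; rewrite /alternate /alt.
have srt n x y : x != y -> sorted (fun x y => x != y) (alternating_word x y n).
  by case: n => // n xy; rewrite alternating_wordS /= alternating_word_path // eq_sym.
split; first by case=> n [] ->; apply: srt; rewrite // eq_sym.
have := filter_all (fun c => (c == a) || (c == b)) w.
case: (filter _ w) => [_ _|c s /= /andP[/orP[]/eqP-> sab] srt_s].
- by exists 0; left.
- exists (size s).+1; left.
  by rewrite alternating_wordS -path_alternating_word.
- exists (size s).+1; right; rewrite alternating_wordS -path_alternating_word //.
  by apply: sub_all sab => c'; rewrite orbC.
Qed.

Lemma filter_pred2_notin v x s :
  v \notin s -> [seq c <- s | (c == v) || (c == x)] = nseq (count_mem x s) x.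
Proof.
elim: s => //= c s IH; rewrite inE negb_or eq_sym => /andP[/negPf cv vs].
by rewrite cv IH //=; case: eqP => [->|].
Qed.

Lemma filter_neq_notin v s : v \notin s -> [seq c <- s | c != v] = s.
Proof.
move=> vs; apply/all_filterP/allP => c cs.
by apply: contraNneq vs => <-.
Qed.

Local Notation neq := (fun x y : T => x != y).

(** The restriction of a word to [v] and [y] consists of copies of [v] separated
    by blocks of copies of [y]; this lemma and the next two read alternation off
    the lengths of the blocks. *)
Lemma path_gap v y n s :
  v != y -> path neq v (nseq n y ++ v :: s) = (n == 1) && path neq v s.
Proof. by move=> vy; case: n => [|[|n]] //=; rewrite !(eqxx, vy) // eq_sym vy. Qed.

Lemma path_last_gap v y n : v != y -> path neq v (nseq n y) = (n <= 1).
Proof. by move=> vy; case: n => [|[|n]] //=; rewrite ?eqxx ?vy. Qed.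

Lemma sorted_first_gap v y n s :
  v != y -> sorted neq (nseq n y ++ v :: s) = (n <= 1) && path neq v s.
Proof. by move=> vy; case: n => [|[|n]] //=; rewrite ?eqxx // eq_sym vy. Qed.

End Alternation.

(** * Inserting vertices into a representing word *)

Section Insertion.
Variable G : sgraph.
Implicit Types (u v x y z : G) (A B C D W : seq G).

(** The graph induced on the letters of [W] is represented by [W]; speaking of
    letters rather than of an induced subgraph lets words grow inside a single
    vertex type. *)
Definition represents_on k W : Prop :=
  {in W, forall x, count_mem x W = k} /\
  {in W &, forall x y, x != y -> edge x y = alt x y W}.

Lemma insert_letter k W W' v :
    represents_on k W -> [seq c <- W' | c != v] = W -> count_mem v W' = k ->
    {in W, forall y, edge v y = alt v y W'} ->
  represents_on k W'.
Proof.
move=> [cW eW] fW cv ev.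
have inW x : x \in W' -> x != v -> x \in W by rewrite -fW mem_filter => -> ->.
split=> [x xW'|x y xW' yW' xy].
  have [->//|xv] := eqVneq x v; rewrite -(cW x (inW _ xW' xv)) -fW count_filter.
  by apply: eq_count => c /=; case: (eqVneq c x) => // ->; rewrite xv.
have [xv|xv] := eqVneq x v.
  by subst x; apply: ev; apply: inW; rewrite // eq_sym.
have [yv|yv] := eqVneq y v.
  by subst y; rewrite edge_sym altC; apply/ev/inW.
rewrite eW ?inW // /alt -fW -filter_predI; congr sorted; apply: eq_filter => c /=.
by case: (eqVneq c x) => [->|_]; rewrite ?xv //; case: (eqVneq c y) => [->|].
Qed.

(** The letter [y] alternates with [v] when it occurs once in each inner gap and
    at most once in each outer one; by uniformity the second condition follows
    from the first. *)
Lemma insert_letter2 A X B v :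
    represents_on 2 (A ++ X ++ B) -> v \notin A ++ X ++ B ->
    {in A ++ X ++ B, forall y, edge v y = (count_mem y X == 1)} ->
  represents_on 2 (A ++ v :: X ++ v :: B).
Proof.
move=> rW vW ev; move: (vW); rewrite !mem_cat !negb_or => /and3P[vA vX vB].
apply: (insert_letter (v := v) rW).
- by do 2!rewrite filter_cat /= eqxx /=; rewrite !filter_neq_notin.
- by do 2!rewrite count_cat /= eqxx /=; rewrite !(count_memPn _).
move=> y yW; have vy : v != y by apply: contraNneq vW => ->.
rewrite ev // /alt; do 2!rewrite filter_cat /= eqxx /=.
rewrite !filter_pred2_notin // sorted_first_gap // path_gap // path_last_gap //.
have := rW.1 y yW; rewrite !count_cat.
move: (count_mem y A) (count_mem y X) (count_mem y B) => a b c; lia.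
Qed.

Lemma insert_letter3 A X Y B v :
    represents_on 3 (A ++ X ++ Y ++ B) -> v \notin A ++ X ++ Y ++ B ->
    {in A ++ X ++ Y ++ B, forall y,
      edge v y = (count_mem y X == 1) && (count_mem y Y == 1)} ->
  represents_on 3 (A ++ v :: X ++ v :: Y ++ v :: B).
Proof.
move=> rW vW ev; move: (vW); rewrite !mem_cat !negb_or => /and4P[vA vX vY vB].
apply: (insert_letter (v := v) rW).
- by do 3!rewrite filter_cat /= eqxx /=; rewrite !filter_neq_notin.
- by do 3!rewrite count_cat /= eqxx /=; rewrite !(count_memPn _).
move=> y yW; have vy : v != y by apply: contraNneq vW => ->.
rewrite ev // /alt; do 3!rewrite filter_cat /= eqxx /=.
rewrite !filter_pred2_notin // sorted_first_gap // !path_gap // path_last_gap //.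
have := rW.1 y yW; rewrite !count_cat.
move: (count_mem y A) (count_mem y X) (count_mem y Y) (count_mem y B) => a b c d; lia.
Qed.

Lemma count_mem_pair x y z :
  x != y -> (count_mem z [:: x; y] == 1) = (z == x) || (z == y).
Proof.
move=> xy; rewrite /= !(eq_sym z).
case: (eqVneq x z) xy => [<-|_ _]; last by case: (y == z).
by rewrite eq_sym => /negPf->.
Qed.

Lemma insert_joint2 A B x y v :
    represents_on 2 (A ++ x :: y :: B) -> v \notin A ++ x :: y :: B -> x != y ->
    (forall z, edge v z = (z == x) || (z == y)) ->
  represents_on 2 (A ++ v :: x :: y :: v :: B).
Proof.
move=> rW vW xy ev; apply: (@insert_letter2 A [:: x; y]) => // z _.
by rewrite count_mem_pair.
Qed.

Lemma insert_joint3 C1 C2 D x y v :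
    represents_on 3 (C1 ++ C2 ++ x :: y :: D) -> v \notin C1 ++ C2 ++ x :: y :: D ->
    x != y -> count_mem x C2 = 1 -> count_mem y C2 = 1 ->
    (forall z, edge v z = (z == x) || (z == y)) ->
  represents_on 3 (C1 ++ v :: C2 ++ v :: x :: y :: v :: D).
Proof.
move=> rW vW xy cx cy ev; apply: (@insert_letter3 C1 C2 [:: x; y]) => // z _.
rewrite count_mem_pair // ev andbC.
by case: (eqVneq z x) => [->|_]; [rewrite cx | case: (eqVneq z y) => [->|]; rewrite ?cy].
Qed.

End Insertion.

(** * Attaching a path *)

Lemma infix2_notinl (T : eqType) (v z : T) s : v \notin s -> infix [:: v; z] s = false.
Proof. by move=> vs; apply: contraNF vs => /mem_infix; apply; rewrite mem_head. Qed.

Lemma infix2_notinr (T : eqType) (v z : T) s : v \notin s -> infix [:: z; v] s = false.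
Proof. by move=> vs; apply: contraNF vs => /mem_infix; apply; rewrite !inE eqxx orbT. Qed.

Lemma path_edge_rev (T : eqType) (p : seq T) (u v : T) :
  path_edge (rev p) u v = path_edge p u v.
Proof. by rewrite /path_edge -(infix_rev [:: u; v]) -(infix_rev [:: v; u]) revK orbC. Qed.

Section Ears.
Variable G : sgraph.
Implicit Types (u v x y z : G) (p ps : seq G) (A B C D W : seq G).

(** An ear in the sense of ear decompositions: only the interior vertices need
    have all their neighbours on the path. *)
Definition ear x ps y : Prop :=
  uniq (x :: rcons ps y) /\
  {in ps, forall v z, edge v z = path_edge (x :: rcons ps y) v z}.

Lemma ear_rev x ps y : ear x ps y -> ear y (rev ps) x.
Proof.
have E : y :: rcons (rev ps) x = rev (x :: rcons ps y).
  by rewrite rev_cons rev_rcons.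
case=> U H; split; rewrite E ?rev_uniq // => v.
by rewrite mem_rev => vps z; rewrite path_edge_rev H.
Qed.

Lemma ear_head x v ps y z :
  ear x (v :: ps) y -> edge v z = (z == x) || (z == head y ps).
Proof.
case; have -> : rcons (v :: ps) y = v :: head y ps :: behead (rcons ps y).
  by case: ps.
move: (head y ps) (behead _) => h r U ->; last exact: mem_head.
move: U; rewrite /= !inE !negb_or => /and4P[/and3P[/negPf xv _ _] /andP[vh vr] _ _].
have vhr : v \notin h :: r by rewrite inE negb_or vh.
rewrite /path_edge 2!infix_consl (infix2_notinl _ vhr) 2!infix_consl.
rewrite (infix2_notinr _ vhr) !prefix_cons !prefix0s.
rewrite eq_sym xv eqxx (negPf vh) /= !(andbT, andbF, orbF).
by rewrite orbC.
Qed.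

Lemma ear_behead x v ps y : ear x (v :: ps) y -> ear v ps y.
Proof.
move=> [U H]; move: (U) => /andP[/=]; rewrite inE negb_or => /andP[xv _] U'.
split=> // u ups z; rewrite H ?inE ?ups ?orbT // /path_edge /=.
have xu : u == x = false.
  by apply: contraTF U => /eqP <-; rewrite /= inE mem_rcons inE ups !orbT.
have vu : u == v = false.
  by apply: contraTF U' => /eqP <-; rewrite /= mem_rcons inE ups !orbT.
by rewrite xu vu andbF.
Qed.

Lemma ear_ends_neq x ps y : ear x ps y -> x != y.
Proof.
by case=> /= /andP[+ _] _; rewrite mem_rcons inE negb_or => /andP[].
Qed.

Lemma ear_notin_ends x ps y v : ear x ps y -> v \in ps -> (v != x) && (v != y).
Proof.
case=> /= /andP[xps +] _ vps; rewrite rcons_uniq => /andP[yps _].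
apply/andP; split; last by apply: contraNneq yps => <-.
by apply: contraNneq xps => <-; rewrite mem_rcons inE vps orbT.
Qed.

Lemma ear_uniq x ps y : ear x ps y -> uniq ps.
Proof. by case=> /= /andP[_]; rewrite rcons_uniq => /andP[]. Qed.

Lemma ear_head_leaf x v w ps y W :
    ear x (v :: w :: ps) y -> {in w :: ps, forall u, u \notin W} ->
  {in W, forall z, edge v z = (z == x)}.
Proof.
move=> eE dW z zW; rewrite (ear_head _ eE) /=.
rewrite (_ : z == w = false) ?orbF //.
by apply: contraTF zW => /eqP ->; rewrite dW ?mem_head.
Qed.

(** The invariant is that the current attachment vertex [x] and [y] are
    consecutive: a leaf [v] hung from [x] turns [x y] into [v x v y], so that
    [v] takes over the place of [x]. *)
Lemma ear_insert2 A B x ps y :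
    ps != [::] -> represents_on 2 (A ++ x :: y :: B) -> ear x ps y ->
    {in ps, forall v, v \notin A ++ x :: y :: B} ->
  exists2 K, represents_on 2 (A ++ K ++ B) & K =i x :: y :: ps.
Proof.
elim: ps A x => // v [|w ps] IH A x _ rW eE dW.
  exists [:: v; x; y; v] => [|z]; last first.
    by rewrite !inE; case: (z == v); rewrite /= ?orbT ?orbF.
  apply: insert_joint2 rW _ (ear_ends_neq eE) (fun z => ear_head z eE).
  by rewrite dW ?mem_head.
have vW : v \notin A ++ [:: x] ++ y :: B by rewrite dW ?mem_head.
have dW' : {in w :: ps, forall u, u \notin A ++ [:: x] ++ y :: B}.
  by move=> u ups; rewrite dW // inE ups orbT.
have rW' : represents_on 2 ((A ++ [:: v; x]) ++ v :: y :: B).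
  rewrite -catA; apply: (@insert_letter2 _ A [:: x]) => // z zW.
  by rewrite (ear_head_leaf eE dW') //= addn0 eqb1 eq_sym.
have [|K rK K_E] := IH _ _ isT rW' (ear_behead eE).
  move=> u ups; rewrite -catA; have := dW' u ups.
  rewrite !mem_cat !inE => /norP[/negPf-> /norP[/negPf-> /norP[/negPf-> /negPf->]]].
  rewrite !orbF orbb; apply: contraTneq ups => ->.
  by case/andP: (ear_uniq eE).
exists ([:: v; x] ++ K); first by rewrite -!catA in rK *.
move=> z; rewrite mem_cat K_E !inE.
by case: (z == v); case: (z == x); case: (z == y); rewrite ?orbT ?orbF.
Qed.

(** Compared with the 2-uniform case, a third copy of each new letter is needed.
    It goes to the cut between [C1] and [C2], which, read cyclically, has one
    further [x] and one further [y] on each side. The cut inherits this property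
    for [v] and [y] once a leaf [v] has been hung from [x]. *)
Lemma ear_insert3 C1 C2 D x ps y :
    ps != [::] -> represents_on 3 (C1 ++ C2 ++ x :: y :: D) -> ear x ps y ->
    {in ps, forall v, v \notin C1 ++ C2 ++ x :: y :: D} ->
    count_mem x C2 = 1 -> count_mem y C2 = 1 ->
  exists U V1 V2, represents_on 3 (C1 ++ U ++ C2 ++ V1 ++ y :: V2 ++ D) /\
    U ++ V1 ++ V2 =i x :: ps.
Proof.
elim: ps C1 C2 x => // v [|w ps] IH C1 C2 x _ rW eE dW cx cy.
  exists [:: v], [:: v; x], [:: v]; split=> [|z]; last first.
    by rewrite !inE; case: (z == v); rewrite /= ?orbT ?orbF.
  apply: insert_joint3 rW _ (ear_ends_neq eE) cx cy (fun z => ear_head z eE).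
  by rewrite dW ?mem_head.
have vW : v \notin C1 ++ C2 ++ [:: x] ++ y :: D by rewrite dW ?mem_head.
have dW' : {in w :: ps, forall u, u \notin C1 ++ C2 ++ [:: x] ++ y :: D}.
  by move=> u ups; rewrite dW // inE ups orbT.
have rW' : represents_on 3 ((C1 ++ [:: v]) ++ (C2 ++ [:: v; x]) ++ v :: y :: D).
  rewrite -!catA; apply: (@insert_letter3 _ C1 C2 [:: x]) => // z zW.
  rewrite (ear_head_leaf eE dW') //= addn0 eqb1 eq_sym.
  by case: eqVneq => [<-|_]; rewrite ?cx ?andbF.
have vC2 : v \notin C2 by apply: contra vW => vC2; rewrite !mem_cat vC2 !orbT.
have vx : x != v by apply: contraNneq vW => ->; rewrite !mem_cat !inE eqxx !orbT.
have vy : y != v by apply: contraNneq vW => ->; rewrite !mem_cat !inE eqxx !orbT.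
have xy := ear_ends_neq eE.
have [|||U [V1 [V2 [rU UE]]]] := IH _ _ _ isT rW' (ear_behead eE).
- move=> u ups; have := dW' u ups; rewrite !(mem_cat, inE).
  have -> : u == v = false.
    by apply: contraTF ups => /eqP->; case/andP: (ear_uniq eE).
  by do 4!(case/norP => /negPf->); move/negPf->.
- by rewrite count_cat /= eqxx (negPf vx) (count_memPn vC2).
- by rewrite count_cat /= cy (negPf xy) eq_sym (negPf vy).
exists (v :: U), ([:: v; x] ++ V1), V2; split; first by rewrite -!catA in rU *.
move=> z; have := UE z; rewrite !(mem_cat, inE) -!orbA.
by case: (z == v); case: (z == x) => //=; rewrite ?orbT ?orbF.
Qed.

End Ears.

(** * Words for melon graphs *)

Section Words.
Variable G : sgraph.
Implicit Types (u v x y z : G) (p ps : seq G) (A B C D W : seq G).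

Lemma represents_on_full k W :
  represents_on k W -> (forall x, x \in W) -> k_word_representable G k.
Proof.
move=> [cW eW] fW; exists W => [x|x y xy]; first exact: cW.
by rewrite alternateE // eW.
Qed.

Section Rounds.
Variables (I : eqType) (Q : I -> seq G).
Implicit Types (L : seq I).

Definition inner L := flatten [seq Q i | i <- L].

Lemma mem_inner L i v : i \in L -> v \in Q i -> v \in inner L.
Proof. by move=> iL vQ; apply/flattenP; exists (Q i) => //; apply: map_f. Qed.

(** Here [P] is the shape of word that the attachment of one interior needs and
    must restore. *)
Lemma insert_rounds (P : seq G -> Prop) L W :
    uniq L -> {in L &, forall i j v, v \in Q i -> v \in Q j -> i = j} ->
    (forall i W', i \in L -> P W' -> {in Q i, forall v, v \notin W'} ->
      exists2 W'', P W'' & W'' =i W' ++ Q i) ->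
    P W -> {in inner L, forall v, v \notin W} ->
  exists2 W', P W' & W' =i W ++ inner L.
Proof.
elim: L W => [|i L IH] W /= uL dQ step PW fW.
  by exists W => // v; rewrite cats0.
case/andP: uL => iL uL.
have [|W1 PW1 W1E] := step i W (mem_head _ _) PW.
  by move=> v vQ; rewrite fW // /inner /= mem_cat vQ.
have [|||W2 PW2 W2E] := IH W1 uL _ _ PW1.
- by move=> j k jL kL; apply: dQ; rewrite inE ?jL ?kL orbT.
- by move=> j W' jL; apply: step; rewrite inE jL orbT.
- move=> v vL; rewrite W1E mem_cat negb_or fW /=; last first.
    by rewrite /inner /= mem_cat; apply/orP; right.
  case/flattenP: (vL) => _ /mapP[j jL ->] vj; apply: contra iL => vi.
  by rewrite (dQ i j _ _ v vi vj) ?inE ?eqxx ?jL ?orbT.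
by exists W2 => // v; rewrite W2E /inner /= !(mem_cat, W1E) orbA.
Qed.

Variables (x y : G) (eQ : forall i, ear x (Q i) y).

Lemma insert_single2 A B i :
    size (Q i) = 1 -> represents_on 2 (A ++ x :: y :: B) ->
    {in Q i, forall v, v \notin A ++ x :: y :: B} ->
  represents_on 2 (A ++ Q i ++ x :: y :: Q i ++ B).
Proof.
case: (Q i) (eQ i) => [|v []] //= eE _ rW fW.
apply: insert_joint2 rW _ (ear_ends_neq eE) (fun z => ear_head z eE).
by rewrite fW ?mem_head.
Qed.

Lemma insert_single3 C1 C2 D i :
    size (Q i) = 1 -> represents_on 3 (C1 ++ C2 ++ x :: y :: D) ->
    {in Q i, forall v, v \notin C1 ++ C2 ++ x :: y :: D} ->
    count_mem x C2 = 1 -> count_mem y C2 = 1 ->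
  represents_on 3 (C1 ++ Q i ++ C2 ++ Q i ++ x :: y :: Q i ++ D).
Proof.
case: (Q i) (eQ i) => [|v []] //= eE _ rW fW cx cy.
apply: insert_joint3 rW _ (ear_ends_neq eE) cx cy (fun z => ear_head z eE).
by rewrite fW ?mem_head.
Qed.

(** The hypotheses say that, cyclically, the letters [x] and [y] displayed cut
    the word into two parts with one further [x] and one further [y] each. The
    first vertex [v] of the path surrounds [x] and has its third copy in front
    of [y]. Then [v] and [y] are consecutive and meet the hypotheses of
    [ear_insert3] for the rest of the path, while the pattern of [x] and [y]
    is left untouched for the next path. *)
Lemma insert_long3 A B D i :
    1 < size (Q i) -> represents_on 3 (A ++ x :: B ++ y :: D) ->
    {in Q i, forall v, v \notin A ++ x :: B ++ y :: D} ->
    count_mem x B = 1 -> count_mem y B = 1 ->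
  exists A' B' D', [/\ represents_on 3 (A' ++ x :: B' ++ y :: D'),
    count_mem x B' = 1, count_mem y B' = 1 &
    A' ++ x :: B' ++ y :: D' =i (A ++ x :: B ++ y :: D) ++ Q i].
Proof.
move: (eQ i); case QE: (Q i) => [|v [|w ps]] // eE _ rW fW cx cy.
have vW : v \notin A ++ [:: x] ++ B ++ y :: D by rewrite fW ?mem_head.
have fW' : {in w :: ps, forall u, u \notin A ++ [:: x] ++ B ++ y :: D}.
  by move=> u ups; rewrite fW // inE ups orbT.
have rW' : represents_on 3 ((A ++ [:: v]) ++ (x :: v :: B) ++ v :: y :: D).
  rewrite -!catA; apply: (@insert_letter3 _ A [:: x] B) => // z zW.
  rewrite (ear_head_leaf eE fW') //= addn0 eqb1 eq_sym.
  by case: eqVneq => [<-|_]; rewrite ?cx.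
have xy := ear_ends_neq eE.
have [yv xv vB yB] : [/\ y != v, x != v, v \notin B & y \in B].
  have yB : y \in B by rewrite -has_pred1 has_count cy.
  split=> //; move: vW; rewrite !(mem_cat, inE) !negb_or.
  - by case/and4P => _ _ _ /andP[]; rewrite eq_sym.
  - by case/and4P => _; rewrite eq_sym.
  - by case/and4P.
have yps u : u \in v :: w :: ps -> (u != x) && (u != y).
  by move=> /fW; rewrite !(mem_cat, inE) !negb_or => /and5P[_ -> _ -> _].
have [|||U [V1 [V2 [rU UE]]]] := ear_insert3 (ps := w :: ps) isT rW' (ear_behead eE).
- move=> u ups; have := fW' u ups; rewrite !(mem_cat, inE).
  have -> : u == v = false.
    by apply: contraTF ups => /eqP->; case/andP: (ear_uniq eE).
  by do 4!(case/norP => /negPf->); move/negPf->.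
- by rewrite /= eqxx (negPf xv) (count_memPn vB).
- by rewrite /= cy (negPf xy) eq_sym (negPf yv).
have nU u : u \in U ++ V1 ++ V2 -> (u != x) && (u != y).
  by rewrite UE; apply: yps.
exists (A ++ v :: U), (v :: B ++ V1), (V2 ++ D); split.
- by move: rU; rewrite -!catA /= -!catA.
- rewrite /= count_cat cx eq_sym (negPf xv) (count_memPn _) //.
  by apply/negP => xV; have := nU x; rewrite !mem_cat xV orbT eqxx => /(_ isT).
- rewrite /= count_cat cy eq_sym (negPf yv) (count_memPn _) //.
  by apply/negP => xV; have := nU y; rewrite !mem_cat xV orbT eqxx andbF => /(_ isT).
move=> z; rewrite [in RHS]mem_cat -UE; have [->|zv] := eqVneq z v.
  by rewrite UE mem_head orbT !(mem_cat, inE) eqxx !orbT.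
rewrite !(mem_cat, inE) (negPf zv) /=.
case: (z \in A); rewrite ?orbT //=; case: (z == x); rewrite ?orbT //=.
case: (z \in B); rewrite ?orbT //=; case: (z == y); rewrite ?orbT //=.
by case: (z \in U); case: (z \in V1); case: (z \in V2); rewrite ?orbT ?orbF.
Qed.

End Rounds.
End Words.

(** The constituent paths without their common ends; an empty interior stands
    for the edge from [s] to [t]. *)
Record interiors (G : sgraph) (s t : G) (m : nat) (Q : 'I_m -> seq G) : Prop :=
  Interiors {
  int_neq : s != t;
  int_ear : forall i, ear s (Q i) t;
  int_disjoint : forall i j v, v \in Q i -> v \in Q j -> i = j;
  int_cover : forall v, [\/ v = s, v = t | exists i, v \in Q i];
  int_edge : edge s t = [exists i, Q i == [::]] }.

Section MelonInteriors.
Variables (G : sgraph) (s t : G) (m : nat) (E : 'I_m -> seq G).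

Lemma path_edge_ends (ps : seq G) :
  uniq (s :: rcons ps t) -> path_edge (s :: rcons ps t) s t = (ps == [::]).
Proof.
case: ps => [|v ps] /=; first by rewrite /path_edge /= !eqxx.
rewrite !(inE, mem_rcons) !negb_or => /and3P[/and3P[sv st sps] /andP[vt _] _].
have sr : s \notin v :: rcons ps t by rewrite !(inE, mem_rcons) !negb_or sv st.
rewrite /path_edge infix_consl (infix2_notinl _ sr) infix_consl (infix2_notinr _ sr).
by rewrite !prefix_cons prefix0s eqxx eq_sym (negPf vt) eq_sym (negPf st).
Qed.

Lemma melon_interiors : melon_paths s t E ->
  exists2 Q, (forall i, E i = s :: rcons (Q i) t) & interiors s t Q.
Proof.
move=> ME; have [Q QE] : exists Q, forall i, E i = s :: rcons (Q i) t.
  apply: (fin_all_exists (U := fun=> seq G) (P := fun i q => E i = s :: rcons q t)).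
  by move=> i; case: (melon_path ME i).
have U i : uniq (s :: rcons (Q i) t) by rewrite -QE; case: (melon_path ME i).
exists Q => //.
have notst i v : v \in Q i -> v != s /\ v != t.
  move=> vQ; move: (U i); rewrite /= mem_rcons rcons_uniq inE negb_or.
  case/andP=> /andP[_ sQ] /andP[tQ _].
  by split; [apply: contraNneq sQ | apply: contraNneq tQ] => <-.
have inE_ i v : v \in Q i -> v \in E i.
  by rewrite QE inE mem_rcons inE => ->; rewrite !orbT.
have dis i j v : v \in Q i -> v \in E j -> i = j.
  move=> vi vj; apply/eqP; apply: contraT => ij.
  have [vs vt] := notst _ _ vi.
  by case: (melon_disjoint ME ij (inE_ _ _ vi) vj) => /eqP;
    rewrite ?(negPf vs) ?(negPf vt).
have path_mem i u v : path_edge (E i) u v -> u \in E i.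
  by case/orP => /mem_infix; apply; rewrite !inE eqxx ?orbT.
split; first exact: melon_ends ME.
- move=> i; split=> // v vQ z; rewrite -QE; apply/idP/idP.
    by case/(melon_edge ME) => j p; rewrite (dis i j v) ?(path_mem _ _ _ p).
  by move=> p; apply/(melon_edge ME); exists i.
- by move=> i j v vi vj; apply: dis vi (inE_ _ _ vj).
- move=> v; have [i] := melon_vertex ME v; rewrite QE inE mem_rcons inE.
  by case/or3P => [/eqP| /eqP|vQ]; [constructor 1|constructor 2|constructor 3; exists i].
apply/idP/existsP => [/(melon_edge ME)[i]|[i Qi]]; last first.
  by apply/(melon_edge ME); exists i; rewrite QE path_edge_ends.
by rewrite QE path_edge_ends // => ?; exists i.
Qed.

End MelonInteriors.

Section Assembly.
Variables (G : sgraph) (s t : G) (m : nat) (Q : 'I_m -> seq G).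
Hypothesis MQ : interiors s t Q.
Implicit Types (W : seq G) (K L : seq 'I_m).

Let Qr i := rev (Q i).

Lemma rev_ear i : ear t (Qr i) s.
Proof. exact/ear_rev/(int_ear MQ). Qed.

Lemma mem_inner_eq (P : 'I_m -> seq G) L :
  (forall i, P i =i Q i) -> inner P L =i inner Q L.
Proof.
by move=> PQ; elim: L => // i L IH v; rewrite /inner /= !mem_cat PQ -/(inner P L) IH.
Qed.

Lemma mem_inner_rev L : inner Qr L =i inner Q L.
Proof. by apply: mem_inner_eq => i v; rewrite mem_rev. Qed.

(** The order of these two letters decides whether [s] and [t] alternate in the
    starting words of [core2] and [core3]; in either order they are consecutive,
    which makes room for paths. *)
Definition core (G : sgraph) (s t : G) := if edge s t then [:: t; s] else [:: s; t].

Let st : s != t.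
Proof. exact: int_neq MQ. Qed.

Lemma represents_on_pair k W :
    count_mem s W = k -> count_mem t W = k -> {subset W <= [:: s; t]} ->
    edge s t = alt s t W ->
  represents_on k W.
Proof.
move=> cs ct sub eW; split=> [x|x y] /sub.
  by rewrite !inE => /orP[]/eqP->.
move=> + /sub; rewrite !inE => /orP[]/eqP-> /orP[]/eqP->; rewrite ?eqxx //.
by rewrite edge_sym altC.
Qed.

Lemma core2 : represents_on 2 ([:: t; s] ++ core s t).
Proof.
have ts : t == s = false by rewrite eq_sym (negPf st).
apply: represents_on_pair; rewrite /core; case: ifP => est;
  rewrite /alt /= ?(eqxx, ts, negPf st, orbT) //= ?(eqxx, ts, st) //.
all: by move=> x; rewrite !inE; do 2!case: (_ == _).
Qed.

Lemma core3 : represents_on 3 ([:: t; s] ++ core s t ++ [:: t; s]).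
Proof.
have ts : t == s = false by rewrite eq_sym (negPf st).
apply: represents_on_pair; rewrite /core; case: ifP => est;
  rewrite /alt /= ?(eqxx, ts, negPf st, orbT) //= ?(eqxx, ts, st) //.
all: by move=> x; rewrite !inE; do 2!case: (_ == _).
Qed.

Definition single := [seq i <- enum 'I_m | size (Q i) == 1].
Definition long := [seq i <- enum 'I_m | 1 < size (Q i)].

Lemma count_ends i : (count_mem s (Q i) = 0) * (count_mem t (Q i) = 0).
Proof.
have notin := ear_notin_ends (int_ear MQ i).
by split; apply/count_memPn/negP => /notin; rewrite eqxx ?andbF.
Qed.

Lemma fresh_inner K L W :
    {subset W <= [:: s; t] ++ inner Q K} -> {in L, forall i, i \notin K} ->
  {in inner Q L, forall v, v \notin W}.
Proof.
move=> WE LK v /flattenP[_ /mapP[i iL ->] vi]; apply/negP => /WE; rewrite mem_cat !inE.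
have /andP[/negPf-> /negPf->] /= := ear_notin_ends (int_ear MQ i) vi.
case/flattenP => _ /mapP[j jK ->] vj; move/negP: (LK i iL); apply.
by rewrite (int_disjoint MQ vi vj).
Qed.

Lemma covered W : {subset [:: s; t] <= W} -> {subset inner Q single <= W} ->
  {subset inner Q long <= W} -> forall v, v \in W.
Proof.
move=> stW sW lW v; case: (int_cover MQ v) => [->|->|[i vi]].
- by apply: stW; rewrite !inE eqxx.
- by apply: stW; rewrite !inE eqxx orbT.
case: (ltngtP (size (Q i)) 1) => si.
- by case: (Q i) si vi.
- by apply/lW/(mem_inner _ vi); rewrite mem_filter si mem_enum.
- by apply/sW/(mem_inner _ vi); rewrite mem_filter si eqxx mem_enum.
Qed.

(** Paths of length two are joined to the last two letters [t s] of the starting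
    word. This yields [t s C2 t s D] with one [s] and one [t] in [C2], so the
    letters [s] and [t] on either side of [C2] are a place where long paths can
    be attached. *)
Lemma melon_3_representable : k_word_representable G 3.
Proof.
pose P1 W := exists C2 D, [/\ W = [:: t; s] ++ C2 ++ t :: s :: D,
  represents_on 3 W, count_mem s C2 = 1 & count_mem t C2 = 1].
have ts : t == s = false by rewrite eq_sym (negPf st).
have [W1 [C2 [D [W1_E r1 cs ct]]] W1E] :
    exists2 W, P1 W & W =i ([:: t; s] ++ core s t ++ [:: t; s]) ++ inner Qr single.
  apply: insert_rounds.
  - by rewrite filter_uniq ?enum_uniq.
  - by move=> i j _ _ v; rewrite !mem_rev; exact: (int_disjoint MQ).
  - move=> i _ + [C2 [D [-> r1 cs ct]]] fW; rewrite mem_filter => /andP[/eqP si _].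
    have siE : size (Qr i) = 1 by rewrite size_rev.
    exists ([:: t; s] ++ (Qr i ++ C2 ++ Qr i) ++ t :: s :: Qr i ++ D).
      exists (Qr i ++ C2 ++ Qr i), (Qr i ++ D); split=> //.
      + by have := insert_single3 rev_ear siE r1 fW ct cs; rewrite -!catA.
      + by rewrite !count_cat !count_rev !count_ends cs.
      + by rewrite !count_cat !count_rev !count_ends ct.
    move=> v; rewrite !(mem_cat, inE); case: (v \in Qr i); rewrite ?orbT //=.
    by rewrite !orbF.
  - exists (core s t), [::]; rewrite /core; split=> //; first exact: core3.
      by case: ifP; rewrite /= eqxx ts.
    by case: ifP; rewrite /= eqxx (negPf st).
  move=> v; rewrite mem_inner_rev; apply: (@fresh_inner [::]) => //.
  by move=> z; rewrite !inE /core; case: ifP; rewrite !inE; do 2!case: (_ == _).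
pose P2 W := exists A B D, [/\ W = A ++ s :: B ++ t :: D,
  represents_on 3 W, count_mem s B = 1 & count_mem t B = 1].
have W1E' : {subset W1 <= [:: s; t] ++ inner Q single}.
  move=> v; rewrite W1E mem_cat mem_inner_rev !mem_cat => /orP[+|->]; rewrite ?orbT //.
  by rewrite !inE /core; case: ifP; rewrite !inE; do 2!case: (_ == _).
have [W2 P2W2 W2E] : exists2 W, P2 W & W =i W1 ++ inner Q long.
  apply: insert_rounds.
  - by rewrite filter_uniq ?enum_uniq.
  - by move=> i j _ _ v; exact: (int_disjoint MQ).
  - move=> i _ + [A [B [D' [-> r2 cs2 ct2]]]] fW.
    rewrite mem_filter => /andP[li _].
    have [A' [B' [D'' [rW' c1 c2 WE]]]] := insert_long3 (int_ear MQ) li r2 fW cs2 ct2.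
    by exists (A' ++ s :: B' ++ t :: D'') => //; exists A', B', D''.
  - exists [:: t], C2, (s :: D); split=> //.
  - apply: (fresh_inner W1E') => i; rewrite !mem_filter => /andP[li _].
    by case: (size (Q i)) li => [|[]].
case: P2W2 => A [B [D' [W2_E r2 _ _]]]; apply: (represents_on_full r2).
apply: covered => v vin; rewrite W2E mem_cat W1E !mem_cat.
- by move: vin; rewrite !inE; do 2!case: (_ == _).
- by rewrite mem_inner_rev vin !orbT.
- by rewrite vin orbT.
Qed.

Lemma insert_ears2 (P : 'I_m -> seq G) x y A B L :
    (forall i, ear x (P i) y) -> {in L, forall i, P i != [::]} -> size L <= 1 ->
    represents_on 2 (A ++ x :: y :: B) ->
    {in inner P L, forall v, v \notin A ++ x :: y :: B} ->
  exists2 K, represents_on 2 (A ++ K ++ B) & K =i x :: y :: inner P L.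
Proof.
move=> eP; case: L => [|i []] // PL _ rW fW; first by exists [:: x; y].
have [||K rK KE] := ear_insert2 _ rW (eP i); first by apply: PL; rewrite mem_head.
  by move=> v vi; apply: fW; rewrite /inner /= cats0.
by exists K; rewrite // /inner /= cats0.
Qed.

(** One long path is attached at the first two letters [t s] of the starting
    word. The last two letters, which are [s] and [t] in one order or the other,
    serve for the paths of length two, which keep them consecutive, and finally
    for the other long path. *)
Lemma few_long_2_representable : size long <= 2 -> k_word_representable G 2.
Proof.
move=> l2.
have [L1 [L2 [longE L1_1 L2_1]]] :
    exists L1 L2, [/\ long = L1 ++ L2, size L1 <= 1 & size L2 <= 1].
  case: long l2 => [|i [|j []]] // _; first by exists [::], [::].
    by exists [:: i], [::].
  by exists [:: i], [:: j].
have nonempty L i : {subset L <= long} -> i \in L -> Q i != [::].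
  by move=> Ll /Ll; rewrite mem_filter => /andP[+ _]; case: (Q i).
have sL1 : {subset L1 <= long} by move=> i iL; rewrite longE mem_cat iL.
have sL2 : {subset L2 <= long} by move=> i iL; rewrite longE mem_cat iL orbT.
have [x [y [P [coreE eP PQ]]]] : exists x y (P : 'I_m -> seq G),
    [/\ core s t = [:: x; y], forall i, ear x (P i) y & forall i, perm_eq (P i) (Q i)].
  rewrite /core; case: ifP => _; [exists t, s, Qr|exists s, t, Q]; split=> // i.
  - exact: rev_ear.
  - exact/permEl/perm_rev.
  - exact: int_ear.
have memP i : P i =i Q i by apply: perm_mem.
have xyE : [:: x; y] =i [:: s; t].
  by rewrite -coreE /core => v; case: ifP; rewrite !inE // orbC.
have [||K1 r1 K1E] := @insert_ears2 Qr t s [::] (core s t) L1 rev_ear _ L1_1 core2.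
- by move=> i /(nonempty _ _ sL1); rewrite -!nilpE rev_nilp.
- move=> v; rewrite mem_inner_rev; apply: (@fresh_inner [::]) => // z.
  by rewrite !inE /core; case: ifP; rewrite !inE; do 2!case: (_ == _).
have K1sub : {subset K1 ++ core s t <= [:: s; t] ++ inner Q L1}.
  move=> v; rewrite coreE mem_cat K1E xyE !inE mem_inner_rev.
  by case: (_ \in _); case: (_ == _); case: (_ == _).
have single_long i : i \in single -> i \notin long.
  by rewrite !mem_filter => /andP[/eqP-> _].
have [W2 [A [B [-> r2]]] W2E] : exists2 W, (exists A B, W = A ++ x :: y :: B /\
    represents_on 2 W) & W =i (K1 ++ core s t) ++ inner P single.
  apply: insert_rounds.
  - by rewrite filter_uniq ?enum_uniq.
  - by move=> i j _ _ v; rewrite !memP; exact: (int_disjoint MQ).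
  - move=> i _ + [A [B [-> r2]]] fW; rewrite mem_filter => /andP[/eqP si _].
    have siE : size (P i) = 1 by rewrite (perm_size (PQ i)).
    exists (A ++ P i ++ x :: y :: P i ++ B).
      exists (A ++ P i), (P i ++ B); rewrite -catA; split=> //.
      exact: insert_single2 eP _ _ _ siE r2 fW.
    move=> v; rewrite !(mem_cat, inE); case: (v \in P i); rewrite ?orbT //=.
    by rewrite !orbF.
  - by exists K1, [::]; rewrite -coreE; split.
  - move=> v; rewrite (mem_inner_eq _ memP); apply: (fresh_inner K1sub) => i iS.
    by apply: contra (single_long i iS); apply: sL1.
have W2sub : {subset A ++ x :: y :: B <= [:: s; t] ++ inner Q (L1 ++ single)}.
  move=> v; rewrite W2E mem_cat (mem_inner_eq _ memP).
  rewrite /inner map_cat flatten_cat catA => vin; rewrite mem_cat.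
  by case/orP: vin => [/K1sub|] ->; rewrite ?orbT.
have [||K3 r3 K3E] := @insert_ears2 P x y A B L2 eP _ L2_1 r2.
- by move=> i /(nonempty _ _ sL2); rewrite -!nilpE /nilp (perm_size (PQ i)).
- move=> v; rewrite (mem_inner_eq _ memP); apply: (fresh_inner W2sub) => i iL2.
  rewrite mem_cat negb_or; apply/andP; split; last first.
    by apply: contraL (sL2 i iL2); apply: single_long.
  have : uniq long by rewrite filter_uniq ?enum_uniq.
  by rewrite longE cat_uniq => /and3P[_ /hasPn/(_ i iL2)].
have sub3 v : v \in A ++ x :: y :: B -> v \in A ++ K3 ++ B.
  rewrite !mem_cat K3E !inE.
  by case: (v \in A); case: (v == x); case: (v == y); case: (v \in B); rewrite ?orbT.
apply: (represents_on_full r3); apply: covered => v vin.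
- apply: sub3; move: vin; rewrite -xyE mem_cat !inE.
  by do 2!case: (v == _); rewrite ?orbT.
- by apply: sub3; rewrite W2E mem_cat (mem_inner_eq _ memP) vin orbT.
move: vin; rewrite longE /inner map_cat flatten_cat mem_cat => /orP[vL1|vL2].
  by apply: sub3; rewrite W2E !mem_cat K1E !inE mem_inner_rev vL1 !orbT.
by rewrite !mem_cat K3E !inE (mem_inner_eq _ memP) vL2 !orbT.
Qed.

End Assembly.

(** * 2-uniform words as chord diagrams *)

Section Positions.
Variables (T : eqType) (x0 : T) (w : seq T).
Hypothesis w2 : uniform 2 w.
Implicit Types (a b : T).

Definition crossing (l r : T -> nat) a b : bool :=
  (l a < l b < r a) && (r a < r b) || (l b < l a < r b) && (r b < r a).

Let pos a := [seq k <- iota 0 (size w) | nth x0 w k == a].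

Definition first_pos a := nth 0 (pos a) 0.
Definition second_pos a := nth 0 (pos a) 1.

Let posE a : pos a = [:: first_pos a; second_pos a].
Proof.
have : size (pos a) = 2.
  rewrite size_filter -(w2 a) -[w in RHS](mkseq_nth x0) count_map.
  by apply: eq_count => k.
by rewrite /first_pos /second_pos; case: (pos a) => [|i [|j []]].
Qed.

Let mem_pos a k :
  (k \in [:: first_pos a; second_pos a]) = (nth x0 w k == a) && (k < size w).
Proof. by rewrite -posE mem_filter mem_iota. Qed.

Let nth_first a : nth x0 w (first_pos a) = a.
Proof. by have := mem_pos a (first_pos a); rewrite mem_head => /esym/andP[/eqP]. Qed.

Let nth_second a : nth x0 w (second_pos a) = a.
Proof.
by have := mem_pos a (second_pos a); rewrite !inE eqxx orbT => /esym/andP[/eqP].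
Qed.

Lemma first_lt_second a : first_pos a < second_pos a.
Proof.
have : sorted ltn (pos a) by apply: sorted_filter (iota_ltn_sorted _ _); exact: ltn_trans.
by rewrite posE /= andbT.
Qed.

Lemma second_pos_lt a : second_pos a < size w.
Proof. by have := mem_pos a (second_pos a); rewrite !inE eqxx orbT => /esym/andP[]. Qed.

Lemma pos_distinct a b : a != b ->
  [/\ first_pos a != first_pos b, first_pos a != second_pos b,
      second_pos a != first_pos b & second_pos a != second_pos b].
Proof.
by move=> ab; split; apply/eqP => /(congr1 (nth x0 w));
  rewrite ?nth_first ?nth_second => /eqP; rewrite (negPf ab).
Qed.

Lemma alt_crossing a b : a != b -> alt a b w = crossing first_pos second_pos a b.
Proof.
move=> ab; have [aa ab' ba bb] := pos_distinct ab.
have la := first_lt_second a; have lb := first_lt_second b.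
(* The restriction of [w] to [a] and [b] lists the letters at the four positions
   in increasing order, so each of the six possible orders gives a word. *)
have E e : sorted ltn e ->
    e =i [:: first_pos a; second_pos a; first_pos b; second_pos b] ->
    [seq c <- w | (c == a) || (c == b)] = [seq nth x0 w k | k <- e].
  move=> se Ee; rewrite -[w in LHS](mkseq_nth x0) filter_map; congr map.
  apply: (irr_sorted_eq ltn_trans ltnn) => //.
    by apply: sorted_filter (iota_ltn_sorted _ _); exact: ltn_trans.
  move=> k; rewrite Ee mem_filter mem_iota /= andb_orl -!mem_pos.
  by rewrite !inE !orbA.
have ba' : b == a = false by rewrite eq_sym (negPf ab).
have [na1 na2] := (nth_first a, nth_second a).
have [nb1 nb2] := (nth_first b, nth_second b).
rewrite /alt /crossing.
move: (first_pos a) (second_pos a) (first_pos b) (second_pos b)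
  la lb aa ab' ba bb na1 na2 nb1 nb2 E => i j k l ij kl ik il jk jl ni nj nk nl E.
have [H|[H|[H|[H|[H|H]]]]] : i < j < k \/ i < k < j /\ j < l \/ i < k /\ l < j
  \/ k < i /\ j < l \/ k < i < l /\ l < j \/ k < l < i by lia.
- rewrite (E [:: i; j; k; l]) /= ?ni ?nj ?nk ?nl ?eqxx /=; [|lia|done].
  by lia.
- rewrite (E [:: i; k; j; l]) /= ?ni ?nj ?nk ?nl ?ab ?ba' /=; [lia|lia|].
  by move=> v; rewrite !inE; do 4!case: (v == _).
- rewrite (E [:: i; k; l; j]) /= ?ni ?nj ?nk ?nl ?eqxx ?andbF /=; [lia|lia|].
  by move=> v; rewrite !inE; do 4!case: (v == _).
- rewrite (E [:: k; i; j; l]) /= ?ni ?nj ?nk ?nl ?eqxx ?andbF /=; [lia|lia|].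
  by move=> v; rewrite !inE; do 4!case: (v == _).
- rewrite (E [:: k; i; l; j]) /= ?ni ?nj ?nk ?nl ?ab ?ba' /=; [lia|lia|].
  by move=> v; rewrite !inE; do 4!case: (v == _).
- rewrite (E [:: k; l; i; j]) /= ?ni ?nj ?nk ?nl ?eqxx /=; [lia|lia|].
  by move=> v; rewrite !inE; do 4!case: (v == _).
Qed.

End Positions.

(** Deliberately symmetric in [p] and [q], so that either order of the two ends
    of a pair may be used. Two pairs interleave on the circle when exactly one
    point of the second is inside the first. *)
Definition inside p q k := (p < k < q) || (q < k < p).

Lemma inside_lt p q k : p < q -> inside p q k = (p < k < q).
Proof. rewrite /inside; lia. Qed.

Lemma insideC p q k : inside p q k = inside q p k.
Proof. by rewrite /inside orbC. Qed.

(** Moving the origin of a circle of [n] positions to [c]. *)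
Definition rotate c n k := if k < c then k + n else k.

(** Inside and outside are exchanged when the cut falls between [p] and [q]; this
    does not depend on [k], so interleaving is invariant under rotation. *)
Lemma inside_rotate c n p q k : p < n -> q < n -> k < n -> k != p -> k != q ->
  inside (rotate c n p) (rotate c n q) (rotate c n k) =
  inside p q k (+) (p < c) (+) (q < c).
Proof.
move=> pn qn kn /eqP kp /eqP kq; rewrite /rotate.
wlog pq : p q pn qn kp kq / p <= q => [W|].
  case: (leqP p q) => [|/ltnW]; first exact: W.
  by move=> qp; rewrite insideC (insideC p) W // addbAC.
case: (ltnP p c) => pc; case: (ltnP q c) => qc; case: (ltnP k c) => kc;
  rewrite /inside ?addbT ?addbF; lia.
Qed.

Lemma rotate_inj c n p q : p < n -> q < n -> rotate c n p = rotate c n q -> p = q.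
Proof. by move=> pn qn; rewrite /rotate; case: (ltnP p); case: (ltnP q); lia. Qed.

Section Chords.
Variables (T : eqType) (e : rel T).
Implicit Types (l r : T -> nat) (u v a : T) (c : seq T) (p q n : nat).

(** The bound [n] is the length of the circle, which rotations need. *)
Record chord_diagram l r n : Prop := ChordDiagram {
  chord_lt : forall v, l v < r v;
  chord_bound : forall v, r v < n;
  chord_distinct : forall u v, u != v ->
    [/\ l u != l v, l u != r v, r u != l v & r u != r v];
  chord_edge : forall u v, u != v -> e u v = crossing l r u v }.

Lemma crossingC l r u v : crossing l r u v = crossing l r v u.
Proof. by rewrite /crossing orbC. Qed.

Lemma crossing_inside l r u v :
    l u < r u -> l v < r v ->
    [/\ l u != l v, l u != r v, r u != l v & r u != r v] ->
  crossing l r u v = (inside (l u) (r u) (l v) != inside (l u) (r u) (r v)).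
Proof.
move=> lu lv [d1 d2 d3 d4]; rewrite !inside_lt // /crossing.
move: (l u) (r u) (l v) (r v) lu lv d1 d2 d3 d4 => i j p q ij pq.
by case: (ltngtP i p) => // ?; case: (ltngtP i q) => // ?;
  case: (ltngtP j p) => // ?; case: (ltngtP j q) => // ? _ _ _ _; lia.
Qed.

Lemma rotate_diagram l r n cut : chord_diagram l r n ->
  chord_diagram
    (fun v => minn (rotate cut n (l v)) (rotate cut n (r v)))
    (fun v => maxn (rotate cut n (l v)) (rotate cut n (r v))) (n + n).
Proof.
move=> D; pose f := rotate cut n; have lr := chord_lt D; have rn := chord_bound D.
have ln v : l v < n := ltn_trans (lr v) (rn v).
have fneq i j : i < n -> j < n -> i != j -> f i != f j.
  by move=> iN jN; apply: contra => /eqP/(rotate_inj iN jN)->.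
have lt' v : minn (f (l v)) (f (r v)) < maxn (f (l v)) (f (r v)).
  have : f (l v) != f (r v); last by rewrite /minn /maxn; case: (ltngtP (f (l v))).
  by rewrite fneq // neq_ltn lr.
have dist u v : u != v ->
    [/\ f (l u) != f (l v), f (l u) != f (r v), f (r u) != f (l v) & f (r u) != f (r v)].
  move=> /(chord_distinct D)[d1 d2 d3 d4].
  by split; rewrite fneq.
have dist' u v : u != v ->
    [/\ minn (f (l u)) (f (r u)) != minn (f (l v)) (f (r v)),
        minn (f (l u)) (f (r u)) != maxn (f (l v)) (f (r v)),
        maxn (f (l u)) (f (r u)) != minn (f (l v)) (f (r v)) &
        maxn (f (l u)) (f (r u)) != maxn (f (l v)) (f (r v))].
  move=> /dist[]; rewrite /minn /maxn.
  by case: (ltngtP (f (l u)) (f (r u))); case: (ltngtP (f (l v)) (f (r v))).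
split=> // [v|u v uv].
  rewrite gtn_max /rotate; have := ln v; have := rn v.
  by case: (ltnP (l v) cut); case: (ltnP (r v) cut); lia.
rewrite (chord_edge D uv) !crossing_inside ?lt' // -/f;
  [|exact: dist'|exact: (chord_distinct D uv)].
have [d1 d2 d3 d4] := chord_distinct D uv.
have insideE k : inside (minn (f (l u)) (f (r u))) (maxn (f (l u)) (f (r u))) k =
    inside (f (l u)) (f (r u)) k.
  by rewrite /minn /maxn; case: ltnP => // _; rewrite insideC.
have insides : (inside (l u) (r u) (l v) != inside (l u) (r u) (r v)) =
   (inside (f (l u)) (f (r u)) (f (l v)) != inside (f (l u)) (f (r u)) (f (r v))).
  rewrite !inside_rotate // 1?eq_sym //.
  by case: (_ < cut); case: (_ < cut); case: (inside _ _ _); case: (inside _ _ _).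
rewrite insides !insideE; rewrite /minn /maxn.
by case: ltnP => // _; rewrite eq_sym.
Qed.

(** The origin is moved to an end of the chord of [s]. If the chords of [s] and
    [t] are disjoint, the end is chosen so that the positions on the far side of
    [s] from [t] come first. *)
Lemma normal_diagram l r n s t : chord_diagram l r n -> s != t ->
  exists l' r' n', [/\ chord_diagram l' r' n',
    forall v, v != s -> l' s < l' v & ~~ e s t -> r' s < l' t].
Proof.
move=> D st; pose cut := if (l s < l t < r s) && ~~ e s t then r s else l s.
exists (fun v => minn (rotate cut n (l v)) (rotate cut n (r v))).
exists (fun v => maxn (rotate cut n (l v)) (rotate cut n (r v))), (n + n).
split; first exact: rotate_diagram.
  have cutE : cut = r s \/ cut = l s by rewrite /cut; case: ifP; [left|right].
  move=> v vs; have := chord_distinct D vs; move: cut cutE => cut cutE.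
  move: (chord_lt D s) (chord_lt D v) (chord_bound D s) (chord_bound D v).
  move: (l s) (r s) (l v) (r v) cutE => i j p q cutE ij pq jn qn [d1 d2 d3 d4].
  rewrite gtn_min !leq_min /rotate; case: cutE => ->; rewrite ltnn ?ij.
    by apply/orP; right; case: (ltnP p j) => ?; case: (ltnP q j) => ?; lia.
  by apply/orP; left; case: (ltnP p i) => ?; case: (ltnP q i) => ?; lia.
move=> nst; have := nst; rewrite (chord_edge D st) /crossing.
have := chord_distinct D st; rewrite /cut {cut} nst andbT.
move: (chord_lt D s) (chord_lt D t) (chord_bound D s) (chord_bound D t).
move: (l s) (r s) (l t) (r t) => i j p q ij pq jn qn [d1 d2 d3 d4] nc.
rewrite gtn_max !leq_min; case: ifP => ipj; rewrite /rotate.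
  have H1 : i < j by []. have H2 : p < j by lia. have H3 : q < j by lia.
  rewrite H1 H2 H3 ltnn; lia.
have H1 : j < i = false by lia.
rewrite H1 ltnn; case: (ltnP p i) => ?; case: (ltnP q i) => ?; lia.
Qed.

Section Chains.
Variables (l r : T -> nat) (n : nat).
Hypothesis D : chord_diagram l r n.
Hypothesis e_irr : irreflexive e.

Definition chord_end v p := (p == l v) || (p == r v).

(** Each chord of the path has both ends on the same side of the pair [p, q], and
    of two crossing chords one has an end between the ends of the other, so the
    side is the same along the path. *)
Lemma chain_inside p q a c :
    path e a c ->
    {in a :: c, forall v, [/\ ~~ chord_end v p, ~~ chord_end v q &
       inside p q (l v) = inside p q (r v)]} ->
  forall u v i j, u \in a :: c -> v \in a :: c -> chord_end u i -> chord_end v j ->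
    inside p q i = inside p q j.
Proof.
move=> ac H.
have {ac} E : {in a :: c, forall v, inside p q (l v) = inside p q (l a)}.
  elim: c a ac H => [|b c IH] a /=; first by move=> _ _ v; rewrite inE => /eqP->.
  case/andP=> ab bc H v; rewrite inE => /orP[/eqP->//|vc].
  rewrite (IH b) //; last by move=> u uc; apply: H; rewrite inE uc orbT.
  have [a1 a2 a3] := H a (mem_head _ _).
  have [b1 b2 b3] := H b (mem_behead (s := [:: a, b & c]) (mem_head b c)).
  have a_b : a != b by apply: contraTneq ab => ->; rewrite e_irr.
  move: ab; rewrite (chord_edge D a_b).
  move: a1 a2 a3 b1 b2 b3 (chord_lt D a) (chord_lt D b).
  rewrite /crossing /chord_end /inside {IH H bc vc a_b}.
  move: (l a) (r a) (l b) (r b) => la ra lb rb; lia.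
have F v i : v \in a :: c -> chord_end v i -> inside p q i = inside p q (l a).
  by move=> vc; have [_ _ lrv] := H v vc; rewrite -(E v vc) => /orP[]/eqP-> //.
by move=> u v i j uc vc /(F u i uc)-> /(F v j vc)->.
Qed.

(** The previous lemma is applied twice: no chord of the second path separates
    [p] from [p'], both being ends of chords of the first path; hence the chords
    of the second path do not interleave with the pair [p, p']. *)
Lemma disjoint_chains a c b d :
    path e a c -> path e b d ->
    {in a :: c & b :: d, forall u v, (u != v) && ~~ e u v} ->
  forall u u' v v' p p' q q',
    u \in a :: c -> u' \in a :: c -> v \in b :: d -> v' \in b :: d ->
    chord_end u p -> chord_end u' p' -> chord_end v q -> chord_end v' q' ->
  inside p p' q = inside p p' q'.
Proof.
move=> ac bd sep u u' v v' p p' q q' uc u'c vd v'd up up' vq vq'.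
have dist x w : x \in a :: c -> w \in b :: d ->
    [/\ l x != l w, l x != r w, r x != l w & r x != r w].
  by move=> xc wd; apply: (chord_distinct D); case/andP: (sep x w xc wd).
have side w : w \in b :: d -> inside (l w) (r w) p = inside (l w) (r w) p'.
  move=> wd; apply: (chain_inside ac _ uc u'c up up') => x xc.
  have [d1 d2 d3 d4] := dist x w xc wd.
  split; first by rewrite /chord_end negb_or eq_sym d1 eq_sym d3.
    by rewrite /chord_end negb_or eq_sym d2 eq_sym d4.
  have /andP[xw] := sep x w xc wd; have wx : w != x by rewrite eq_sym.
  rewrite (chord_edge D xw) crossingC crossing_inside ?(chord_lt D) //.
    by move/negbNE/eqP.
  exact: chord_distinct D _ _ wx.
apply: (chain_inside bd _ vd v'd vq vq') => w wd.
have [wp wp'] : ~~ chord_end w p /\ ~~ chord_end w p'.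
  have [d1 d2 d3 d4] := dist u w uc wd; have [e1 e2 e3 e4] := dist u' w u'c wd.
  by case/orP: up => /eqP->; case/orP: up' => /eqP->; rewrite /chord_end !negb_or;
    split; apply/andP.
split=> //; move: (side w wd) wp wp'; rewrite /chord_end !(inside_lt _ (chord_lt D w)).
move: (chord_lt D w); move: (l w) (r w) => lw rw lrw; clear -lrw.
wlog pp' : p p' / p < p'; last by rewrite !(inside_lt _ pp'); lia.
move=> W; case: (ltngtP p p') => [|p'p|->]; first exact: W.
  by move=> E A B; rewrite !(insideC p p'); apply: W.
by move=> _ _ _; rewrite /inside; lia.
Qed.

End Chains.
End Chords.

(** * Three long paths exclude a chord diagram *)

Lemma ear_path (G : sgraph) (x : G) v ps y : ear x (v :: ps) y -> path edge v ps.
Proof.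
elim: ps x v => //= w ps IH x v eE.
by rewrite (ear_head w eE) eqxx orbT /= (IH v w) //; apply: ear_behead eE.
Qed.

Lemma ear_first (G : sgraph) (x : G) v ps y : 0 < size ps -> ear x (v :: ps) y ->
  edge x v && ~~ edge y v.
Proof.
case: ps => // w ps _ eE; rewrite !(edge_sym _ v) !(ear_head _ eE) eqxx /=.
rewrite eq_sym (negPf (ear_ends_neq eE)) /=.
have : w \in v :: w :: ps by rewrite !inE eqxx orbT.
by move=> /(ear_notin_ends eE)/andP[_]; rewrite eq_sym.
Qed.

Lemma ear_last (G : sgraph) (x : G) v ps y : 0 < size ps -> ear x (v :: ps) y ->
  edge y (last v ps) && ~~ edge x (last v ps).
Proof.
case/lastP: ps => // ps w _ eE; rewrite last_rcons.
have := ear_rev eE; rewrite -rcons_cons rev_rcons; apply: ear_first.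
by rewrite size_rev.
Qed.

(** Each [x] lies on the far side of [s] from [t], each [y] on the far side of
    [t] from [s], and the pairs [x, y] do not interleave; so the second pair is
    nested between the other two. The point [z2] belongs to the second path and
    lies between the chords of [s] and [t], hence outside that strip. *)
Lemma middle_chain s2 t1 t2 x1 x2 x3 y1 y2 y3 z2 :
    x3 < s2 -> s2 < t1 -> t1 < y1 < t2 -> t1 < y2 < t2 -> t1 < y3 < t2 ->
    s2 < z2 -> ~~ (t1 < z2 < t2) -> x1 < x2 -> x2 < x3 ->
    inside x1 y1 x2 = inside x1 y1 y2 -> inside x1 y1 x2 = inside x1 y1 z2 ->
    inside x3 y3 x2 = inside x3 y3 y2 -> inside x3 y3 x2 = inside x3 y3 z2 ->
  False.
Proof.
move=> x3s st /andP[ty1 yt1] /andP[ty2 yt2] /andP[ty3 yt3] sz zt x12 x23.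
have xy1 : x1 < y1 by lia.
have xy3 : x3 < y3 by lia.
rewrite !(inside_lt _ xy1) !(inside_lt _ xy3); lia.
Qed.

(** Here and in the next lemma the ends of the crossing chords of [s] and [t]
    follow each other as [s1 t1 s2 t2]. Each path has a chord [p, q] that crosses
    only [s] and a chord [u, v] that crosses only [t]. Both chords [p, q] are
    around [s2]. If the chords [u, v] are around the same end of [t], each of the
    two paths would have to be the outer one; if not, each path reaches three of the
    four arcs into which the ends of [s] and [t] cut the circle, and two pairs
    interleave. *)
Lemma pair_inner s1 t1 s2 t2 p q u v p' q' u' v' :
    s1 < t1 -> t1 < s2 -> s2 < t2 ->
    t1 < p < s2 -> s2 < q < t2 -> t1 < p' < s2 -> s2 < q' < t2 ->
    (s1 < u < t1) && (t1 < v < s2) || (s2 < u < t2) && (t2 < v) ->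
    (s1 < u' < t1) && (t1 < v' < s2) || (s2 < u' < t2) && (t2 < v') ->
    inside u q p' = inside u q q' -> inside u' q' p = inside u' q' q ->
    inside p v p' = inside p v q' -> inside p' v' p = inside p' v' q ->
    inside u q p' = inside u q v' -> inside u' q' p = inside u' q' v ->
  p != p' -> q != q' -> False.
Proof.
move=> st ts s2t /andP[tp ps] /andP[sq qt] /andP[tp' p's] /andP[sq' q't].
case/orP => /andP[/andP[a1 a2]]; [case/andP=> a3 a4|move=> a3];
case/orP => /andP[/andP[b1 b2]];
  [case/andP=> b3 b4|move=> b3|case/andP=> b3 b4|move=> b3].
- have uq : u < q by lia. have uq' : u' < q' by lia.
  rewrite !(inside_lt _ uq) !(inside_lt _ uq') => + + _ _ _ _; lia.
- have uq : u < q by lia.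
  rewrite !(inside_lt _ uq) => _ _ _ _ + _; lia.
- have uq' : u' < q' by lia.
  rewrite !(inside_lt _ uq') => _ _ _ _ _ +; lia.
- have pv : p < v by lia. have pv' : p' < v' by lia.
  rewrite !(inside_lt _ pv) !(inside_lt _ pv') => _ _ + + _ _; lia.
Qed.

(** Both chords [p, q] are around [s1], across the origin. *)
Lemma pair_outer s1 t1 s2 t2 p q u v p' q' u' v' :
    s1 < t1 -> t1 < s2 -> s2 < t2 ->
    s1 < p < t1 -> t2 < q -> s1 < p' < t1 -> t2 < q' ->
    (s1 < u < t1) && (t1 < v < s2) || (s2 < u < t2) && (t2 < v) ->
    (s1 < u' < t1) && (t1 < v' < s2) || (s2 < u' < t2) && (t2 < v') ->
    inside p q p' = inside p q v' -> inside p' q' p = inside p' q' v ->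
    inside p q p' = inside p q u' -> inside p' q' p = inside p' q' u ->
    inside v q p' = inside v q u' -> inside v' q' p = inside v' q' u ->
  p != p' -> q != q' -> False.
Proof.
move=> st ts s2t /andP[tp ps] qt /andP[tp' p's] q't.
have pq : p < q by lia. have pq' : p' < q' by lia.
rewrite !(inside_lt _ pq) !(inside_lt _ pq').
case/orP => /andP[/andP[a1 a2]]; [case/andP=> a3 a4|move=> a3];
case/orP => /andP[/andP[b1 b2]];
  [case/andP=> b3 b4|move=> b3|case/andP=> b3 b4|move=> b3].
- by move=> + + _ _ _ _; lia.
- have vq : v < q by lia.
  rewrite !(inside_lt _ vq) => _ _ _ _ + _; lia.
- have vq' : v' < q' by lia.
  rewrite !(inside_lt _ vq') => _ _ _ _ _ +; lia.
- by move=> _ _ + + _ _; lia.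
Qed.



Section ThreeLong.
Variables (G : sgraph) (s t : G) (m : nat) (Q : 'I_m -> seq G).
Hypothesis MQ : interiors s t Q.

Lemma inner_separated i j u v :
  i != j -> u \in Q i -> v \in Q j -> (u != v) && ~~ edge u v.
Proof.
move=> ij ui vj; apply/andP; split.
  by apply: contraNneq ij => uv; subst v; rewrite (int_disjoint MQ ui vj).
rewrite (int_ear MQ i).2 //; apply: contraNN ij => p.
have : v \in s :: rcons (Q i) t.
  by case/orP: p => /mem_infix; apply; rewrite !inE eqxx ?orbT.
have /andP[/negPf vs /negPf vt] := ear_notin_ends (int_ear MQ j) vj.
by rewrite inE mem_rcons inE vs vt /= => vi; rewrite (int_disjoint MQ vi vj).
Qed.

Variables (l r : G -> nat) (n : nat).
Hypothesis D : chord_diagram (@edge G) l r n.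

(** In a normalised diagram the chord of the first vertex [a i] of a long path
    runs from between the ends of [s] to beyond its right end. *)
Lemma at_most_two_long i1 i2 i3 :
    i1 != i2 -> i1 != i3 -> i2 != i3 ->
    1 < size (Q i1) -> 1 < size (Q i2) -> 1 < size (Q i3) -> False.
Proof.
have [l' [r' [n' [D' smin st_order]]]] := normal_diagram D (int_neq MQ).
clear l r n D; move: l' r' n' D' smin st_order => l r n D smin st_order.
move=> n12 n13 n23 l1 l2 l3; have st := int_neq MQ.
pose long i := 1 < size (Q i).
pose a i := head s (Q i); pose b i := last s (Q i); pose c i := behead (Q i).
have QE i : long i -> Q i = a i :: c i by rewrite /long /a /c; case: (Q i).
have bE i : long i -> b i = last (a i) (c i) by rewrite /long /a /b /c; case: (Q i).
have ac i : long i -> path edge (a i) (c i).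
  by move=> li; apply: (@ear_path _ s _ _ t); rewrite -QE //; apply: int_ear.
have c0 i : long i -> 0 < size (c i) by move=> li; have := li; rewrite /long QE.
have aQ i : long i -> a i \in a i :: c i by rewrite mem_head.
have bQ i : long i -> b i \in a i :: c i by move=> /bE->; apply: mem_last.
have ears i : long i -> ear s (a i :: c i) t by move=> li; rewrite -QE //; apply: int_ear.
have Ea i : long i -> edge s (a i) && ~~ edge t (a i).
  by move=> li; apply: ear_first (c0 i li) (ears i li).
have Eb i : long i -> edge t (b i) && ~~ edge s (b i).
  by move=> li; rewrite bE //; apply: ear_last (c0 i li) (ears i li).
have nst i v : long i -> v \in a i :: c i -> (v != s) && (v != t).
  by move=> li; apply: ear_notin_ends (ears i li).
have sep i j p p' q q' u u' v v' : long i -> long j -> i != j ->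
    u \in a i :: c i -> u' \in a i :: c i -> v \in a j :: c j -> v' \in a j :: c j ->
    chord_end l r u p -> chord_end l r u' p' ->
    chord_end l r v q -> chord_end l r v' q' ->
    inside p p' q = inside p p' q'.
  move=> li lj ij; apply: (disjoint_chains D (@edge_irr G) (ac i li) (ac j lj)).
  by move=> x y; rewrite -!QE //; apply: inner_separated.
have el v : chord_end l r v (l v) by rewrite /chord_end eqxx.
have er v : chord_end l r v (r v) by rewrite /chord_end eqxx orbT.
have lr := chord_lt D.
have ts : t != s by rewrite eq_sym.
have ls_lt := smin t ts.
have aP i : long i -> [/\ l s < l (a i), l (a i) < r s, r s < r (a i) &
    ~~ crossing l r t (a i)].
  move=> li; have /andP[as_ at_] := nst i _ li (aQ i li).
  have := Ea i li; rewrite !(chord_edge D) ?(eq_sym _ (a i)) // => /andP[+ ->].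
  rewrite /crossing; have := smin _ as_.
  by move: (l s) (r s) (l (a i)) (r (a i)) => *; split=> //; lia.
have bP i : long i -> crossing l r t (b i) && ~~ crossing l r s (b i) && (l s < l (b i)).
  move=> li; have /andP[as_ at_] := nst i _ li (bQ i li).
  by have := Eb i li; rewrite !(chord_edge D) ?(eq_sym _ (b i)) // smin // andbT.
have neq_a i j : long i -> long j -> i != j -> l (a i) != l (a j) /\ r (a i) != r (a j).
  move=> li lj ij; have aiQ : a i \in Q i by rewrite QE ?aQ.
  have ajQ : a j \in Q j by rewrite QE ?aQ.
  by have /andP[/(chord_distinct D)[? _ _ ?] _] := inner_separated ij aiQ ajQ.
case: (boolP (edge s t)) => [est|nst_]; last first.
  have rslt := st_order nst_.
  pose y i := if l (b i) < l t then r (b i) else l (b i).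
  have ey i : chord_end l r (b i) (y i) by rewrite /y; case: ifP.
  have yP i : long i -> l t < y i < r t.
    move=> li; have /andP[/andP[+ _] _] := bP i li; rewrite /crossing /y.
    by move: (l t) (r t) (l (b i)) (r (b i)) => *; case: ifP; lia.
  have zP i : long i -> ~~ (l t < r (a i) < r t).
    move=> li; have [_ lars _] := aP i li; rewrite /crossing; move: lars rslt.
    by move: (l s) (r s) (l t) (r t) (l (a i)) (r (a i)); clear; lia.
  (* Of three disjoint paths, the one whose chord at [s] starts between the other
     two is enclosed by them. *)
  have mid i j k : long i -> long j -> long k -> i != j -> j != k ->
      l (a i) < l (a j) -> l (a j) < l (a k) -> False.
    move=> li lj lk ij jk xij xjk; have kj : k != j by rewrite eq_sym.
    have [_ xk _ _] := aP k lk; have [_ _ zj _] := aP j lj.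
    apply: (middle_chain xk rslt (yP i li) (yP j lj) (yP k lk) zj (zP j lj) xij xjk).
    - by apply: (sep i j) => //; rewrite ?aQ ?bQ.
    - by apply: (sep i j) => //; rewrite ?aQ ?bQ.
    - by apply: (sep k j) => //; rewrite ?aQ ?bQ.
    - by apply: (sep k j) => //; rewrite ?aQ ?bQ.
  have n21 : i2 != i1 by rewrite eq_sym.
  have n31 : i3 != i1 by rewrite eq_sym.
  have n32 : i3 != i2 by rewrite eq_sym.
  have [d12 _] := neq_a _ _ l1 l2 n12; have [d13 _] := neq_a _ _ l1 l3 n13.
  have [d23 _] := neq_a _ _ l2 l3 n23.
  case: (ltngtP (l (a i1)) (l (a i2))) d12 => // x12 _;
  case: (ltngtP (l (a i1)) (l (a i3))) d13 => // x13 _;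
  case: (ltngtP (l (a i2)) (l (a i3))) d23 => // x23 _.
  - exact: mid x12 x23.
  - exact: mid x13 x23.
  - by move: (ltn_trans x12 (ltn_trans x23 x13)); rewrite ltnn.
  - exact: mid x13 x12.
  - exact: mid x12 x13.
  - by move: (ltn_trans x13 (ltn_trans x23 x12)); rewrite ltnn.
  - exact: mid x23 x13.
  - exact: mid x23 x12.
have [ls_t lt_s s_rt] : [/\ l s < l t, l t < r s & r s < r t].
  have := est; rewrite (chord_edge D st) /crossing; move: ls_lt.
  by move: (l s) (r s) (l t) (r t); clear => *; split; lia.
have bP' i : long i -> (l s < l (b i) < l t) && (l t < r (b i) < r s) ||
    (r s < l (b i) < r t) && (r t < r (b i)).
  move=> li; have /andP[bs bt] := nst i _ li (bQ i li).
  have [d1 d2 d3 d4] := chord_distinct D bs.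
  have /andP[/andP[]] := bP i li; rewrite /crossing.
  move: ls_t lt_s s_rt d1 d2 d3 d4 (lr (b i)).
  by move: (l s) (r s) (l t) (r t) (l (b i)) (r (b i)); clear; lia.
(* The comparison tells around which end of [s] the chord of [a i] lies; two of
   the three paths must agree on it. *)
have two i j : long i -> long j -> i != j ->
    (l t < l (a i)) = (l t < l (a j)) -> False.
  move=> li lj ij E; have ji : j != i by rewrite eq_sym.
  have [xi ri si ti] := aP i li; have [xj rj sj tj] := aP j lj.
  have [dl dr] := neq_a _ _ li lj ij.
  have aP' k : long k -> if l t < l (a k) then r (a k) < r t
                        else (l (a k) < l t) && (r t < r (a k)).
    move=> lk; have /andP[_ /(chord_distinct D)[d1 d2 d3 d4]] := nst k _ lk (aQ k lk).
    have [k1 k2 k3 +] := aP k lk; rewrite /crossing.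
    move: ls_t lt_s s_rt d1 d2 d3 d4 k1 k2 k3.
    move: (l s) (r s) (l t) (r t) (l (a k)) (r (a k)); clear => *.
    by case: ifP; lia.
  have ai := aP' i li; have aj := aP' j lj.
  case: ifP ai E aj => lti ai /esym ltj; rewrite ltj => aj.
    apply: (pair_inner ls_t lt_s s_rt _ _ _ _ (bP' i li) (bP' j lj) _ _ _ _ _ _ dl dr);
      rewrite ?lti ?ltj ?xi ?ri ?si ?xj ?rj ?sj //.
    - by apply: (sep i j) => //; rewrite ?aQ ?bQ.
    - by apply: (sep j i) => //; rewrite ?aQ ?bQ.
    - by apply: (sep i j) => //; rewrite ?aQ ?bQ.
    - by apply: (sep j i) => //; rewrite ?aQ ?bQ.
    - by apply: (sep i j) => //; rewrite ?aQ ?bQ.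
    - by apply: (sep j i) => //; rewrite ?aQ ?bQ.
  have [/andP[ai1 ai2] /andP[aj1 aj2]] := (ai, aj).
  apply: (pair_outer ls_t lt_s s_rt _ _ _ _ (bP' i li) (bP' j lj) _ _ _ _ _ _ dl dr);
    rewrite ?xi ?xj //.
  - by apply: (sep i j) => //; rewrite ?aQ ?bQ.
  - by apply: (sep j i) => //; rewrite ?aQ ?bQ.
  - by apply: (sep i j) => //; rewrite ?aQ ?bQ.
  - by apply: (sep j i) => //; rewrite ?aQ ?bQ.
  - by apply: (sep i j) => //; rewrite ?aQ ?bQ.
  - by apply: (sep j i) => //; rewrite ?aQ ?bQ.
case E12: ((l t < l (a i1)) == (l t < l (a i2))).
  exact: two (eqP E12).
case E13: ((l t < l (a i1)) == (l t < l (a i3))).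
  exact: two (eqP E13).
apply: (two i2 i3) => //; move: E12 E13.
by case: (l t < l (a i1)); case: (l t < l (a i2)); case: (l t < l (a i3)).
Qed.

End ThreeLong.

Lemma word_diagram (G H : sgraph) (g : H -> G) (w : seq G) (x0 : G) :
    injective g -> (forall x y, edge (g x) (g y) = edge x y) ->
    uniform 2 w -> represents w ->
  chord_diagram (@edge H) (first_pos x0 w \o g) (second_pos x0 w \o g) (size w).
Proof.
move=> g_inj gE w2 rw; split=> [v|v|u v uv|u v uv] /=.
- exact: first_lt_second.
- exact: second_pos_lt.
- by apply: pos_distinct => //; rewrite (inj_eq g_inj).
have guv : g u != g v by rewrite (inj_eq g_inj).
rewrite -gE -[RHS](alt_crossing x0 w2 guv).
by apply/idP/idP => [/(rw _ _ guv)|] /(alternateE _ guv) // /(rw _ _ guv).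
Qed.

(** In a 1-uniform word any two letters alternate, and they still do in its
    square. *)
Lemma one_two_representable (G : sgraph) :
  k_word_representable G 1 -> k_word_representable G 2.
Proof.
case=> w w1 rw; exists (w ++ w) => [x|x y xy]; first by rewrite count_cat w1.
suff [xy_w xy_ww] : alt x y w /\ alt x y (w ++ w).
  split=> _; first exact/alternateE.
  by apply/(rw _ _ xy)/alternateE.
have yx : y == x = false by rewrite eq_sym (negPf xy).
have : [seq c <- w | (c == x) || (c == y)] \in [:: [:: x; y]; [:: y; x]].
  have in_w z : z \in w by rewrite -has_pred1 has_count w1.
  have uw : uniq w by apply: count_mem_uniq => z; rewrite w1 in_w.
  have : perm_eq [seq c <- w | (c == x) || (c == y)] [:: x; y].
    apply: uniq_perm; rewrite ?filter_uniq //= ?inE ?xy // => c.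
    by rewrite mem_filter in_w andbT !inE.
  move=> pE; have := perm_size pE; have := perm_mem pE.
  have := filter_uniq (fun c => (c == x) || (c == y)) uw.
  case: (filter _ w) {pE} => [|c1 [|c2 []]] //=; rewrite inE andbT => c12 mE _.
  have := mE c1; have := mE c2; rewrite !inE !eqxx orbT /=.
  move=> /esym/orP[]/eqP E2 /esym/orP[]/eqP E1; subst;
    by rewrite ?eqxx ?orbT // in c12 *.
by rewrite /alt filter_cat !inE => /orP[]/eqP->; rewrite /= ?xy ?yx.
Qed.

Lemma no_2_representation (G H : sgraph) (g : H -> G) s t m (E : 'I_m -> seq H) i1 i2 i3 :
    injective g -> (forall x y, edge (g x) (g y) = edge x y) ->
    melon_paths s t E -> i1 != i2 -> i1 != i3 -> i2 != i3 ->
    2 < path_length (E i1) -> 2 < path_length (E i2) -> 2 < path_length (E i3) ->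
  ~ k_word_representable G 2.
Proof.
move=> g_inj gE ME n12 n13 n23 + + + [w w2 rw].
have [Q QE MQ] := melon_interiors ME; rewrite !QE /path_length /= !size_rcons !ltnS.
exact: (at_most_two_long MQ (word_diagram (g s) g_inj gE w2 rw) n12 n13 n23).
Qed.

Lemma M3_M4_not_2 (G H : sgraph) : melon_M3 H \/ melon_M4 H -> contains_induced G H ->
  ~ k_word_representable G 2.
Proof.
move=> MH [A [f [h fK hK] fE]].
have g_inj : injective (val \o h).
  by apply: inj_comp val_inj _; apply: can_inj hK.
have gE x y : edge ((val \o h) x) ((val \o h) y) = edge x y.
  by rewrite -[in RHS](hK x) -[in RHS](hK y) fE.
case: MH => [[s [t [E [ME lE]]]]|[s [t [E [ME [i0 _ lE]]]]]].
  pose o k (lt : k < 3) := Ordinal lt.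
  by apply: (no_2_representation (i1 := @o 0 isT) (i2 := @o 1 isT) (i3 := @o 2 isT)
    g_inj gE ME).
pose o k (lt : k < 3) := lift i0 (Ordinal lt).
by apply: (no_2_representation (i1 := @o 0 isT) (i2 := @o 1 isT) (i3 := @o 2 isT)
    g_inj gE ME); rewrite ?(inj_eq lift_inj) ?lE // eq_sym neq_lift.
Qed.

(** * Induced melon graphs *)

Section InducedMelon.
Variables (G : sgraph) (s t : G) (m : nat) (E : 'I_m -> seq G).
Hypothesis ME : melon_paths s t E.
Variables (k : nat) (f : 'I_k -> 'I_m).
Hypotheses (f_inj : injective f) (k_gt0 : 0 < k).
Hypothesis st_edge : edge s t -> exists j, path_length (E (f j)) = 1.

Definition union_paths : {set G} := [set x | [exists j, x \in E (f j)]].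

Definition sub_path j : seq (induced union_paths) := pmap insub (E (f j)).

Let valK (p : seq G) : {subset p <= union_paths} ->
  map val (pmap insub p : seq (induced union_paths)) = p.
Proof.
move=> pA; rewrite (pmap_filter (insubK _)); apply/all_filterP/allP => x xp.
by rewrite /= isSome_insub pA.
Qed.

Lemma val_sub_path j : map val (sub_path j) = E (f j).
Proof. by apply: valK => x xE; rewrite inE; apply/existsP; exists j. Qed.

Lemma path_edge_map (T T' : eqType) (h : T -> T') p x y : injective h ->
  path_edge (map h p) (h x) (h y) = path_edge p x y.
Proof.
move=> h_inj; have infix_map u v : infix [:: h u; h v] (map h p) = infix [:: u; v] p.
  elim: p => // c p IH; rewrite map_cons !infix_consl IH !prefix_cons inj_eq //.
  by case: p {IH} => //= c' p; rewrite inj_eq // !prefix0s.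
by rewrite /path_edge !infix_map.
Qed.

(** A path outside the chosen family meets the union of the family only in [s]
    and [t], so the only edge it can add to the induced subgraph is the edge
    from [s] to [t]; [st_edge] says that this one is present already. *)
Lemma induced_melon : exists s' t' : induced union_paths, melon_paths s' t' sub_path.
Proof.
have ends j : exists q, E (f j) = s :: rcons q t by case: (melon_path ME (f j)).
have sub j x : x \in E (f j) -> x \in union_paths.
  by move=> xE; rewrite inE; apply/existsP; exists j.
pose j0 := Ordinal k_gt0; have [q0 q0E] := ends j0.
have sA : s \in union_paths by apply: (sub j0); rewrite q0E mem_head.
have tA : t \in union_paths by apply: (sub j0); rewrite q0E inE mem_rcons mem_head orbT.
pose s' : induced union_paths := Sub s sA; pose t' : induced union_paths := Sub t tA.
have mem_sub j (x : induced union_paths) : (x \in sub_path j) = (val x \in E (f j)).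
  by rewrite -val_sub_path mem_map //; apply: val_inj.
have len j : path_length (sub_path j) = path_length (E (f j)).
  by rewrite /path_length -val_sub_path size_map.
exists s', t'; split => //.
- exact: melon_ends ME.
- move=> j; split.
    rewrite -(map_inj_uniq val_inj) val_sub_path.
    by case: (melon_path ME (f j)).
  have [q qE] := ends j; exists (pmap insub q); apply: (inj_map val_inj).
  rewrite val_sub_path qE /= map_rcons valK // => x xq; apply: (sub j).
  by rewrite qE inE mem_rcons inE xq !orbT.
- move=> i j x ij; rewrite !mem_sub => xi xj.
  have fij : f i != f j by rewrite inj_eq.
  by case: (melon_disjoint ME fij xi xj) => ?; [left|right]; apply: val_inj.
- by move=> i j; rewrite !len => li lj; apply/f_inj/(melon_simple ME).
- by move=> x; have := valP x; rewrite inE => /existsP[j xj]; exists j; rewrite mem_sub.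
move=> x y; have edgeE : edge x y = edge (val x) (val y) by [].
rewrite edgeE; split=> [xy|[j p]]; last first.
  apply/(melon_edge ME); exists (f j); rewrite -val_sub_path path_edge_map //.
  exact: val_inj.
suff [j p] : exists j, path_edge (E (f j)) (val x) (val y).
  by exists j; rewrite -(path_edge_map _ _ _ val_inj) val_sub_path.
have [i p] := (melon_edge ME (val x) (val y)).1 xy.
have [/codomP[j jE]|fi] := boolP (i \in codom f); first by exists j; rewrite -jE.
have end_of (z : induced union_paths) : val z \in E i -> val z = s \/ val z = t.
  move=> zi; have := valP z; rewrite inE => /existsP[j zj].
  apply: (melon_disjoint ME _ zi zj); apply: contraNneq fi => ->; exact: codom_f.
have [xi yi] : val x \in E i /\ val y \in E i.
  by case/orP: p => /mem_infix pE; split; apply: pE; rewrite !inE eqxx ?orbT.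
have st_path : edge s t -> exists j, path_edge (E (f j)) s t.
  move=> /st_edge[j]; have [q qE] := ends j; rewrite qE /path_length /= size_rcons => -[].
  by move/size0nil => q_nil; exists j; rewrite qE q_nil /path_edge /= !eqxx.
move: xy; case: (end_of x xi) => ->; case: (end_of y yi) => ->; rewrite ?edge_irr //.
by rewrite edge_sym => /st_path[j pj]; exists j; rewrite /path_edge orbC.
Qed.

End InducedMelon.

Lemma long_contains (G : sgraph) s t m (E : 'I_m -> seq G) i1 i2 i3 :
    melon_paths s t E -> uniq [:: i1; i2; i3] ->
    all (fun i => 2 < path_length (E i)) [:: i1; i2; i3] ->
  exists H, (melon_M3 H \/ melon_M4 H) /\ contains_induced G H.
Proof.
move=> ME u3 l3; have [Q QE MQ] := melon_interiors ME.
have self (H : sgraph) : isomorphic H H by exists id => //; exists id.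
have len k (f : 'I_k -> 'I_m) j : path_length (sub_path E f j) = path_length (E (f j)).
  by rewrite /path_length -[in RHS]val_sub_path size_map.
have [est|nst] := boolP (edge s t).
  have /existsP[i0 /eqP Q0] : [exists i, Q i == [::]] by rewrite -(int_edge MQ).
  have E0 : path_length (E i0) = 1 by rewrite QE Q0.
  pose f := tnth [tuple i0; i1; i2; i3].
  have f_inj : injective f.
    apply/tuple_uniqP; rewrite cons_uniq u3 andbT.
    by apply/negP => /(allP l3); rewrite E0.
  have [|s' [t' ME']] := @induced_melon _ s t m E ME 4 f f_inj isT.
    by move=> _; exists ord0.
  exists (induced (union_paths E f)); split; last by exists (union_paths E f).
  right; exists s', t', (sub_path E f); split=> //; exists ord0; rewrite ?len // => i.
  case: (unliftP ord0 i) => [j ->|->] // _; rewrite len /f tnthS.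
  by have /all_tnthP := (l3 : all _ [tuple i1; i2; i3]); apply.
pose f := tnth [tuple i1; i2; i3].
have f_inj : injective f by apply/tuple_uniqP.
have [|s' [t' ME']] := @induced_melon _ s t m E ME 3 f f_inj isT.
  by rewrite (negPf nst).
exists (induced (union_paths E f)); split; last by exists (union_paths E f).
left; exists s', t', (sub_path E f); split=> // i; rewrite len.
by have /all_tnthP := (l3 : all _ [tuple i1; i2; i3]); apply.
Qed.

Theorem theorem3 (M : sgraph) (hM : melon M) :
  representation_number M 3 <->
  exists H : sgraph, (melon_M3 H \/ melon_M4 H) /\ contains_induced M H.
Proof.
have [s [t [m [E ME]]]] := hM; have [Q QE MQ] := melon_interiors ME.
split=> [[_ _ min3]|[H [MH cH]]]; last first.
  have not2 := M3_M4_not_2 MH cH; split=> // [|j j0 jG].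
    exact: melon_3_representable MQ.
  case: j j0 jG => [|[|[|j]]] // _ jG.
  by case: (not2 (one_two_representable jG)).
have [/(few_long_2_representable MQ)/(min3 2 isT) //|] := leqP (size (long Q)) 2.
have : uniq (long Q) by rewrite filter_uniq ?enum_uniq.
have : all (fun i => 2 < path_length (E i)) (long Q).
  apply/allP => i; rewrite mem_filter => /andP[li _].
  by rewrite QE /path_length /= size_rcons.
case: (long Q) => [|i1 [|i2 [|i3 L]]] //= /and4P[l1 l2 l3 _] + _.
rewrite !inE !negb_or => /and4P[/and3P[n12 n13 _] /andP[n23 _] _ _].
apply: (long_contains ME (i1 := i1) (i2 := i2) (i3 := i3)) => /=.
  by rewrite !inE negb_or n12 n13 n23.
by rewrite l1 l2 l3.
Qed.
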